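(* Let $A\in\mathbb{R}^{k\times n}$ have full row rank, let $C=(c_{lj})\in\mathbb{R}^{m\times n}$ and $\boldsymbol{b}\in\mathbb{R}^k$, and suppose that the linear lexicographic program $$\text{(LLP)}\qquad \operatorname{lexmax}\ C\boldsymbol{x}\quad \text{s.t. } A\boldsymbol{x}=\boldsymbol{b},\ \boldsymbol{x}\geq \boldsymbol{0}$$ is feasible and lexicographically bounded from above. Let $\boldsymbol{a}_j$ be the $j$-th column of $A$ and let $\boldsymbol{c}^l=(c_{l1},\dots,c_{ln})^\top$ be the (transposed) $l$-th row of $C$. Define sets $S^{(l)}\subseteq[n]$ and bases $B^{(l)}$ inductively as follows. Set $S^{(1)}=[n]$. For $l=1,\dots,m$: (i) let $B^{(l)}\subseteq S^{(l)}$ be any primal-dual feasible basis of the ordinary (single-objective) linear program $$\text{(P}_l\text{)}\qquad \max\ \boldsymbol{c}^l_{S^{(l)}}\cdot \boldsymbol{y}\quad\text{s.t. } A_{S^{(l)}}\boldsymbol{y}=\boldsymbol{b},\ \boldsymbol{y}\geq\boldsymbol{0},$$ whose variables are indexed by $S^{(l)}$; (ii) set $S^{(l+1)}=\{j\in S^{(l)}\colon c_{lj}=(\boldsymbol{c}^{l}_{B^{(l)}})^{\top}A_{B^{(l)}}^{-1}\boldsymbol{a}_j\}$. Then $B^{(m)}$ is a primal-dual feasible basis of (LLP).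
   Context: Notation: $[n]=\{1,\dots,n\}$. For a matrix $M$ (resp. vector $\boldsymbol{v}$) and a set $X$ of column (resp. entry) indices, $M_X$ (resp. $\boldsymbol{v}_X$) is the restriction to the columns (resp. entries) indexed by $X$. Lexicographic order on $\bar{\mathbb{R}}^m$, where $\bar{\mathbb{R}}=\mathbb{R}\cup\{-\infty,+\infty\}$: $\boldsymbol{x}<_{\text{lex}}\boldsymbol{y}$ if there is $j\in[m]$ with $x_j<y_j$ and $x_h=y_h$ for all $h<j$; $\boldsymbol{x}\leqslant_{\text{lex}}\boldsymbol{y}$ if $\boldsymbol{x}<_{\text{lex}}\boldsymbol{y}$ or $\boldsymbol{x}=\boldsymbol{y}$. In a linear lexicographic program, ''$\operatorname{lexmax} C\boldsymbol{x}$'' means that one looks for a feasible $\boldsymbol{x}^*$ with $C\boldsymbol{x}\leqslant_{\text{lex}}C\boldsymbol{x}^*$ for every feasible $\boldsymbol{x}$. The program is lexicographically bounded from above if the supremum, with respect to $\leqslant_{\text{lex}}$ in $\bar{\mathbb{R}}^m$, of $\{C\boldsymbol{x}\colon \boldsymbol{x}\text{ feasible}\}$ belongs to $\mathbb{R}^m$ (all its components are finite). A basis is a set $B$ of column indices such that $A_B$ is square and invertible; it is feasible if $A_B^{-1}\boldsymbol{b}\geq\boldsymbol{0}$. The reduced cost of $x_j$ with respect to a feasible basis $B$ is the $m$-dimensional vector $\overline{\boldsymbol{c}}_j=\boldsymbol{c}_j-C_BA_B^{-1}\boldsymbol{a}_j$, where $\boldsymbol{c}_j$ is the $j$-th column of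 $C$. A primal-dual feasible basis is a feasible basis $B$ such that $\overline{\boldsymbol{c}}_j\leqslant_{\text{lex}}\boldsymbol{0}$ for all $j$. For single-objective programs ($m=1$) these are the ordinary notions (all reduced costs are $\leq 0$); for (P$_l$), the index $j$ ranges over $S^{(l)}$. *)

(* Defs.v *)
From mathcomp Require Import all_boot all_order all_algebra.
From mathcomp Require Import boolp classical_sets reals ereal.

Set Implicit Arguments.
Unset Strict Implicit.
Unset Printing Implicit Defensive.

Import Order.TTheory GRing.Theory Num.Theory.

Local Open Scope ring_scope.
Local Open Scope classical_set_scope.

(* Stated over any ordered type so as to apply both to R^m and to (\bar R)^m. *)
Definition lexlt d (T : porderType d) m (x y : 'cV[T]_m) : Prop :=
  exists j : 'I_m, (x j ord0 < y j ord0)%O /\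
    forall h : 'I_m, (h < j)%N -> x h ord0 = y h ord0.

Definition lexle d (T : porderType d) m (x y : 'cV[T]_m) : Prop :=
  lexlt x y \/ x = y.

Definition is_lexsup d (T : porderType d) m (E : set 'cV[T]_m) (s : 'cV[T]_m) :
    Prop :=
  (forall y, E y -> lexle y s) /\
  (forall u, (forall y, E y -> lexle y u) -> lexle s u).

Section LexicographicPrograms.
Variable R : realType.

Definition feasible_set k n (A : 'M[R]_(k, n)) (b : 'cV[R]_k) : set 'cV[R]_n :=
  [set x | A *m x = b /\ forall j, 0 <= x j ord0].

Definition lex_bounded_above k n m (A : 'M[R]_(k, n)) (C : 'M[R]_(m, n))
    (b : 'cV[R]_k) : Prop :=
  exists v : 'cV[R]_m,
    is_lexsup [set map_mx EFin (C *m x) | x in feasible_set A b]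
              (map_mx EFin v).

Definition restrict_cols p n (M : 'M[R]_(p, n)) (X : {set 'I_n}) :
    'M[R]_(p, #|X|) :=
  colsub (@enum_val _ (mem X)) M.

(* A_B retyped as a square matrix. The default value 0 is used only when
   #|B| <> k, a case excluded by is_basis. *)
Definition basis_mx k n (A : 'M[R]_(k, n)) (B : {set 'I_n}) : 'M[R]_k :=
  conform_mx 0 (restrict_cols A B).

Definition is_basis k n (A : 'M[R]_(k, n)) (B : {set 'I_n}) : Prop :=
  #|B| = k /\ basis_mx A B \in unitmx.

(* The inverse of A_B, with rows indexed by B; meaningful when B is a basis. *)
Definition basis_inv k n (A : 'M[R]_(k, n)) (B : {set 'I_n}) :
    'M[R]_(#|B|, k) :=
  conform_mx 0 (invmx (basis_mx A B)).

Definition feasible_basis k n (A : 'M[R]_(k, n)) (b : 'cV[R]_k)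
    (B : {set 'I_n}) : Prop :=
  is_basis A B /\ forall i : 'I_#|B|, 0 <= (basis_inv A B *m b) i ord0.

Definition reduced_cost k n m (A : 'M[R]_(k, n)) (C : 'M[R]_(m, n))
    (B : {set 'I_n}) (j : 'I_n) : 'cV[R]_m :=
  col j C - restrict_cols C B *m basis_inv A B *m col j A.

(* B is a primal-dual feasible basis of the program
     lexmax C_S y  s.t.  A_S y = b, y >= 0,
   whose variables keep their original indices, so that (A_S)_B = A_B and
   (C_S)_B = C_B for B included in S. The order lexle on vectors with a single
   entry is the usual order, so m = 1 gives the ordinary notion. *)
Definition primal_dual_feasible_basis k n m (A : 'M[R]_(k, n))
    (C : 'M[R]_(m, n)) (b : 'cV[R]_k) (S B : {set 'I_n}) : Prop :=
  [/\ B \subset S, feasible_basis A b B &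
      forall j, j \in S -> lexle (reduced_cost A C B j) 0].

End LexicographicPrograms.

(* Main.v *)
Require Import Defs.
From mathcomp Require Import all_boot all_order all_algebra.
From mathcomp Require Import boolp classical_sets reals ereal.

Set Implicit Arguments.
Unset Strict Implicit.
Unset Printing Implicit Defensive.

Import Order.TTheory GRing.Theory Num.Theory.

Local Open Scope ring_scope.
Local Open Scope classical_set_scope.

(** Let [y_l] be the price vector [c^l_(B_l) A_(B_l)^-1] of the [l]-th stage, so
    that the [l]-th stage reduced cost of [x_j] is [c_lj - y_l a_j].  Let [D] be
    the last basis.

    The prices of a basis are characterised by complementary slackness: they are
    the only row vector [y] with [c_j = y a_j] on the basic columns.  Passing
    from [S l] to [S l.+1] keeps exactly the columns where this equality holds
    for [y_l].  The sets [S l] decrease, so [D], contained in the last of them,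
    satisfies the equality for all earlier [y_l]; it satisfies it for the last
    one because the basic columns of [D] have zero reduced cost.  Hence the
    prices of [D] for the objective [c^l] are [y_l] for every [l] at once
    ([reduced_cost_prices]), and the vector reduced cost of [x_j] with respect
    to [D] consists of the reduced costs of [x_j] in the successive stages.

    Its first nonzero entry, if any, lies at a stage where [x_j] is still
    present, since [x_j] is only discarded at a stage where its reduced cost is
    nonzero; there, dual feasibility of that stage makes the entry negative. *)

Section Bases.
Variable R : realType.

(** Abstracting [#|B|] to a variable [p] allows [p = k] to be eliminated by
    substitution, after which both retypings become the identity. *)
Lemma mulmx_conform_invmx k p (M : 'M[R]_(k, p)) :
    p = k -> conform_mx (0 : 'M_k) M \in unitmx ->
  let N : 'M_(p, k) := conform_mx 0 (invmx (conform_mx (0 : 'M_k) M)) in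
  M *m N = 1%:M /\ N *m M = 1%:M.
Proof.
move=> pk; subst p; rewrite !conform_mx_id => Mu /=.
by rewrite mulmxV ?mulVmx.
Qed.

Lemma mulmx_basis_inv k n (A : 'M[R]_(k, n)) (B : {set 'I_n}) :
  is_basis A B -> restrict_cols A B *m basis_inv A B = 1%:M.
Proof. by case=> Bk Bu; case: (mulmx_conform_invmx Bk Bu). Qed.

Lemma mul_basis_inv_mx k n (A : 'M[R]_(k, n)) (B : {set 'I_n}) :
  is_basis A B -> basis_inv A B *m restrict_cols A B = 1%:M.
Proof. by case=> Bk Bu; case: (mulmx_conform_invmx Bk Bu). Qed.

Lemma col_restrict_cols p n (M : 'M[R]_(p, n)) (B : {set 'I_n}) i :
  col i (restrict_cols M B) = col (enum_val i) M.
Proof. by apply/colP=> r; rewrite !mxE. Qed.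

Lemma reduced_cost_basic k n m (A : 'M[R]_(k, n)) (C : 'M[R]_(m, n))
    (B : {set 'I_n}) j :
  is_basis A B -> j \in B -> reduced_cost A C B j = 0.
Proof.
move=> AB jB; rewrite /reduced_cost -(enum_rankK_in jB jB).
rewrite -!col_restrict_cols !colE -mulmxA [basis_inv A B *m _]mulmxA.
by rewrite mul_basis_inv_mx // mul1mx subrr.
Qed.

(** Any [Y] that prices the basic columns correctly must be [C_B A_B^-1],
    because [A_B] is invertible.  This is what lets one basis inherit the prices
    computed from another. *)
Lemma reduced_cost_prices k n m (A : 'M[R]_(k, n)) (C : 'M[R]_(m, n))
    (B : {set 'I_n}) (Y : 'M[R]_(m, k)) :
    is_basis A B -> (forall j, j \in B -> col j C = Y *m col j A) ->
  forall j, reduced_cost A C B j = col j C - Y *m col j A.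
Proof.
move=> AB YB j; rewrite /reduced_cost.
suff -> : restrict_cols C B = Y *m restrict_cols A B.
  by rewrite -[_ *m basis_inv A B]mulmxA mulmx_basis_inv // mulmx1.
apply/matrixP=> l i.
have := YB _ (enum_valP i); rewrite -!col_restrict_cols [col i _]colE.
by rewrite [col i _]colE mulmxA -!colE => /colP/(_ l); rewrite ![col _ _ _ _]mxE.
Qed.

Lemma lexle1_entry (x y : 'cV[R]_1) : lexle x y -> x ord0 ord0 <= y ord0 ord0.
Proof. by case=> [[j [+ _]]|->//]; rewrite ord1; apply: ltW. Qed.

(** Well-foundedness of the index set: a nonzero vector has a first nonzero
    entry, and only the sign of that one matters. *)
Lemma lexle0_first_nonzero m (x : 'cV[R]_m) :
    (forall l : 'I_m, (forall h : 'I_m, (h < l)%N -> x h ord0 = 0) ->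
      x l ord0 <= 0) ->
  lexle x 0.
Proof.
move=> x_le0; have [->|/cV0Pn[i xi]] := eqVneq x 0; first by right.
left; case: (@arg_minnP _ i (fun l => x l ord0 != 0) (fun l => l : nat) xi) => l xl l_min.
have x_lt (h : 'I_m) : (h < l)%N -> x h ord0 = 0.
  by move=> hl; apply/eqP; apply: contraTT hl => /l_min; rewrite -leqNgt.
exists l; split=> [|h /x_lt ->]; last by rewrite mxE.
by rewrite mxE lt_neqAle xl x_le0.
Qed.

End Bases.

(* 0-based indexing: S l and B l are the l+1-st set and basis. *)
Theorem theorem1 (R : realType) (k n m : nat) (m_gt0 : (0 < m)%N)
  (A : 'M[R]_(k, n)) (C : 'M[R]_(m, n)) (b : 'cV[R]_k)
  (A_full_row_rank : row_free A)
  (LLP_feasible : feasible_set A b !=set0)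
  (LLP_bounded : lex_bounded_above A C b)
  (S B : nat -> {set 'I_n})
  (S_first : S 0%N = [set: 'I_n]%SET)
  (B_pdf : forall l : 'I_m,
    primal_dual_feasible_basis A (row l C) b (S l) (B l))
  (S_next : forall l : 'I_m,
    S l.+1 = [set j in S l |
      C l j == (restrict_cols (row l C) (B l) *m basis_inv A (B l)
                  *m col j A) ord0 ord0]%SET) :
  primal_dual_feasible_basis A C b [set: 'I_n]%SET (B m.-1).
Proof.
pose y (l : 'I_m) := restrict_cols (row l C) (B l) *m basis_inv A (B l).
pose Y := \matrix_(l < m) y l.
have last_lt : (m.-1 < m)%N by rewrite prednK.
pose last := Ordinal last_lt.
have YE (l : 'I_m) j : (Y *m col j A) l ord0 = (y l *m col j A) ord0 ord0.
  by rewrite [LHS]mxE [RHS]mxE; apply: eq_bigr => i _; rewrite [Y _ _]mxE.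
have stageE (l : 'I_m) j :
    reduced_cost A (row l C) (B l) j ord0 ord0
    = (col j C - Y *m col j A) l ord0.
  by rewrite [RHS]mxE [X in _ = _ + X]mxE YE /reduced_cost !mxE.
have S_nextE (l : 'I_m) j :
    (j \in S l.+1) = (j \in S l) && ((col j C - Y *m col j A) l ord0 == 0).
  rewrite S_next inE; congr (_ && _).
  by rewrite [X in _ = (X == _)]mxE [X in _ + X]mxE YE [col j C l _]mxE subr_eq0.
have S_anti l l' : (l <= l')%N -> (l' <= m)%N -> S l' \subset S l.
  elim: l' => [|l' IH]; first by rewrite leqn0 => /eqP->.
  rewrite leq_eqVlt => /predU1P[->//|ll'] l'm.
  apply: fintype.subset_trans (IH ll' (ltnW l'm)).
  by apply/fintype.subsetP=> j; rewrite (S_nextE (Ordinal l'm)) => /andP[].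
have [BS [B_basis B_ge0] _] := B_pdf last.
have B_last_next : B last \subset S last.+1.
  apply/fintype.subsetP=> j jB; rewrite S_nextE (fintype.subsetP BS) //= -stageE.
  by rewrite reduced_cost_basic // mxE.
(* [B last] lies in every [S l.+1], that is, satisfies the equalities that
   define all of them; the last one holds by [B_last_next]. *)
have Y_prices j : j \in B last -> col j C = Y *m col j A.
  move=> jB; apply/eqP; rewrite -subr_eq0; apply/eqP/colP=> l.
  have : j \in S l.+1.
    have le_l : (l.+1 <= last.+1)%N by rewrite /= prednK.
    apply: (fintype.subsetP (S_anti _ _ le_l (ltn_ord last))).
    exact: (fintype.subsetP B_last_next).
  by rewrite S_nextE => /andP[_ /eqP->]; rewrite mxE.
split=> // j _; rewrite (reduced_cost_prices B_basis Y_prices).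
apply: lexle0_first_nonzero => l r0.
(* Vanishing entries before [l] mean that [x_j] survived all those stages. *)
have jS : j \in S l.
  have : forall h, (h <= l)%N -> j \in S h.
    elim=> [|h IH] hl; first by rewrite S_first inE.
    have hm : (h < m)%N := ltn_trans hl (ltn_ord l).
    by rewrite (S_nextE (Ordinal hm)) IH ?(ltnW hl) //= r0.
  exact.
have [_ _ /(_ j jS)/lexle1_entry] := B_pdf l.
by rewrite stageE [X in _ <= X]mxE.
Qed.
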